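(* For all integers $n\ge 0$, we have $\overline{f}_{\mathrm{BSD}}(n)=s(n)$, where $\overline{f}_{\mathrm{BSD}}(n)$ is the number of short binary signed-digit representations of $n$ and $s$ is the Stern sequence.
   Context: A binary signed-digit (BSD) representation of an integer $n$ is an expression $n=\sum_{j=0}^{\infty}\epsilon_j 2^j$ with every $\epsilon_j\in\{1,0,-1\}$ and only finitely many $\epsilon_j$ nonzero; representations are identified with their digit sequences $(\epsilon_j)_{j\ge 0}$ (so leading zeros are irrelevant). The leading term is $\epsilon_\ell 2^\ell$, where $\ell$ is the largest index with $\epsilon_\ell\ne 0$. A BSD representation is short if its leading two digits are neither $1,-1$ nor $-1,1$; that is, with $\ell$ the index of the leading term, it is not the case that $\ell\ge 1$ and $(\epsilon_\ell,\epsilon_{\ell-1})\in\{(1,-1),(-1,1)\}$. (A representation with $\ell=0$ is short.) $\overline{f}_{\mathrm{BSD}}(n)$ denotes the number of short BSD representations of $n$. The all-zero expansion of $0$ has no leading term and is not counted as a short BSD representation, so $\overline{f}_{\mathrm{BSD}}(0)=0$. The Stern sequence is defined by $s(0)=0$, $s(1)=1$, and $s(2n)=s(n)$, $s(2n+1)=s(n+1)+s(n)$ for $n\ge 1$. *)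

(* Defs.v *)
From HB Require Import structures.
From mathcomp Require Import all_boot all_order all_algebra finmap zify.
From mathcomp Require Import classical_sets cardinality.

Set Implicit Arguments.
Unset Strict Implicit.
Unset Printing Implicit Defensive.

Import GRing.Theory.
Local Open Scope ring_scope.

(* [e j] is the digit of weight [2 ^ j]. *)
Definition digit_seq := {fsfun nat -> int with 0}.

Definition is_BSD (n : int) (e : digit_seq) : Prop :=
  (forall j : nat, [\/ e j = 1, e j = 0 | e j = -1]) /\
  n = \sum_(j <- finsupp e) e j * 2 ^+ j.

Definition is_leading (e : digit_seq) (l : nat) : Prop :=
  e l <> 0 /\ forall j : nat, (l < j)%N -> e j = 0.

(* The zero sequence has no leading index, hence is not short. *)
Definition is_short (e : digit_seq) : Prop :=
  exists l : nat, is_leading e l /\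
    ~ ((1 <= l)%N /\
       ((e l = 1 /\ e l.-1 = -1) \/ (e l = -1 /\ e l.-1 = 1))).

Definition short_BSD (n : int) : set digit_seq :=
  [set e | is_BSD n e /\ is_short e]%classic.

(* [fset_set A] is empty when [A] is infinite, so this is the number of short
   representations only when [short_BSD n] is finite. *)
Definition fbarBSD (n : int) : nat := #|` fset_set (short_BSD n)|%fset.

(* [k] is a bound on the recursion depth; any [k >= n] gives the same value;
   the usual recurrence is [stern_double] and [stern_doubleS]. *)
Fixpoint stern_rec (k n : nat) : nat :=
  if k is k'.+1 then
    if (n <= 1)%N then n
    else if odd n then (stern_rec k' n./2.+1 + stern_rec k' n./2)%N
    else stern_rec k' n./2
  else n.

Definition stern (n : nat) : nat := stern_rec n n.

Lemma stern_rec_stable (k n : nat) : (n <= k)%N -> stern_rec k n = stern n.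
Proof.
have stab a b m : (m <= a)%N -> (m <= b)%N -> stern_rec a m = stern_rec b m.
  elim: a b m => [|a IH] [|b] m //=.
  - by rewrite leqn0 => /eqP -> /=.
  - by rewrite leqn0 => _ /eqP -> /=.
  - move=> lea leb; case: leqP => // gt1.
    by case: ifP => on; rewrite !(IH b) //; lia.
by move=> le_nk; apply: stab.
Qed.

Lemma sternE (n : nat) : (1 < n)%N ->
  stern n = if odd n then (stern n./2.+1 + stern n./2)%N else stern n./2.
Proof.
case: n => [|n] // gt1.
rewrite {1}/stern [LHS]/= leqNgt gt1 /=.
by case: ifP => on; rewrite !stern_rec_stable //; lia.
Qed.

Lemma stern0 : stern 0 = 0%N. Proof. by []. Qed.

Lemma stern1 : stern 1 = 1%N. Proof. by []. Qed.

Lemma stern_double (n : nat) : (1 <= n)%N -> stern (2 * n) = stern n.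
Proof.
move=> n1; rewrite sternE; last by lia.
have -> : odd (2 * n) = false by lia.
by congr stern; lia.
Qed.

Lemma stern_doubleS (n : nat) :
  (1 <= n)%N -> stern (2 * n + 1) = (stern (n + 1) + stern n)%N.
Proof.
move=> n1; rewrite sternE; last by lia.
have -> : odd (2 * n + 1) = true by lia.
by congr (stern _ + stern _)%N; lia.
Qed.

(* Main.v *)
Require Import Defs.
From mathcomp Require Import all_boot all_order all_algebra.
From mathcomp Require Import cardinality.
From mathcomp Require Import finmap zify classical_sets.

Set Implicit Arguments.
Unset Strict Implicit.
Unset Printing Implicit Defensive.

Import GRing.Theory.

(** Deleting the digit of weight 1 turns a representation of [n] with last
    digit [d] into a representation of [(n - d) / 2], and conversely a digit can
    be appended to any representation.  The point is that for [n >= 2] this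
    preserves shortness in both directions ([is_short_scons]).  Indeed [n] is
    then not a single digit, so that what remains has a leading digit.  If it
    has at least two digits, the leading two are the same before and after;
    if it is a single [1] or [-1], shortness could only be lost by appending the
    opposite digit, but this gives [1] or [-1], which is not [n].  Hence, for
    [n >= 2], the parity of [n] decides which last digits occur and, for
    [m >= 1],

      short (2 m) = short (m) followed by 0,
      short (2 m + 1) = short (m) followed by 1, or short (m + 1) followed by -1,

    where the last two families are disjoint ([short_BSD_double],
    [short_BSD_doubleS]).  This is the recurrence of the Stern sequence.

    The correspondence breaks down at [n = 1]: the representation [1] leaves the
    zero sequence, which is not short, and [1] followed by [-1] is not short.
    For [0] and [1] the representations are bounded in length instead: a short
    one with at least two digits has a value of absolute value at least 2
    ([short_value_ge2]), so that only one-digit representations remain. *)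

Section ShortRepresentations.

Local Open Scope ring_scope.

Implicit Types (e : digit_seq) (d n m : int).

(** * Appending and deleting the last digit *)

Definition value e : int := \sum_(j <- finsupp e) e j * 2 ^+ j.

Definition digit d : Prop := [\/ d = 1, d = 0 | d = -1].

Definition scons d e : digit_seq :=
  [fsfun j in (0%N |` [fset i.+1 | i in finsupp e])%fset =>
     if j is i.+1 then e i else d].

Definition stail e : digit_seq :=
  [fsfun j in [fset i.-1 | i in finsupp e]%fset => e j.+1].

Lemma scons0 d e : scons d e 0%N = d.
Proof. by rewrite fsfunE fset1U1. Qed.

Lemma sconsS d e j : scons d e j.+1 = e j.
Proof.
rewrite fsfunE in_fset1U /=; case: ifPn => // /imfsetP nj.
by symmetry; apply: fsfun_dflt; apply/negP => je; apply: nj; exists j.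
Qed.

Lemma stailE e j : stail e j = e j.+1.
Proof.
rewrite fsfunE; case: ifPn => // /imfsetP nj.
by symmetry; apply: fsfun_dflt; apply/negP => je; apply: nj; exists j.+1.
Qed.

Lemma scons_stail e : scons (e 0%N) (stail e) = e.
Proof. by apply/fsfunP => -[|j]; rewrite ?scons0 // sconsS stailE. Qed.

Lemma scons_inj d : injective (scons d).
Proof. by move=> e f ef; apply/fsfunP => j; rewrite -(sconsS d e) ef sconsS. Qed.

(** A fixed range of summation, as in [\sum_(j < N)], makes the values of [e]
    and [scons d e] comparable; their supports are awkward to relate. *)
Lemma valueE N e : (forall j, (N <= j)%N -> e j = 0) ->
  value e = \sum_(j < N) e j * 2 ^+ j.
Proof.
move=> e0; rewrite -(big_mkord xpredT (fun j => e j * 2 ^+ j)).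
rewrite [RHS](bigID (mem (finsupp e))) /= [X in _ + X]big1 ?addr0; last first.
  by move=> j /= je; rewrite [e j](fsfun_dflt je) mul0r.
rewrite -big_filter; apply: perm_big; apply: uniq_perm.
- exact: fset_uniq.
- by rewrite filter_uniq // iota_uniq.
move=> j; rewrite mem_filter mem_index_iota /=.
case: (boolP (j \in finsupp e)) => //= je.
by symmetry; rewrite ltnNge; apply/negP => /e0/eqP; rewrite -memNfinsupp je.
Qed.

Lemma eventually0 e : exists N, forall j, (N <= j)%N -> e j = 0.
Proof.
exists (\max_(i <- finsupp e) i).+1 => j Nj; apply: fsfun_dflt.
apply/negP => je; move: Nj; rewrite leqNgt ltnS.
by rewrite (@leq_bigmax_seq _ _ xpredT id).
Qed.

Lemma value_scons d e : value (scons d e) = d + 2 * value e.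
Proof.
have [N e0] := eventually0 e.
rewrite (@valueE N.+1) => [|[|j] // Nj]; last by rewrite sconsS e0.
rewrite big_ord_recl scons0 mulr1 (valueE e0) mulr_sumr; congr (_ + _).
by apply: eq_bigr => i _; rewrite lift0 sconsS exprS mulrCA.
Qed.

Lemma is_BSD_scons n d e :
  is_BSD n (scons d e) <->
  [/\ digit d, forall j, digit (e j) & n = d + 2 * value e].
Proof.
rewrite -value_scons; split=> [[dig ->]|[dd de ->]].
  split=> // [|j]; first by have := dig 0%N; rewrite scons0.
  by have := dig j.+1; rewrite sconsS.
by split=> // -[|j]; rewrite ?scons0 ?sconsS; [exact: dd | exact: de].
Qed.

Lemma is_leading_scons d e l : is_leading (scons d e) l.+1 <-> is_leading e l.
Proof.
rewrite /is_leading sconsS; split=> -[el e0]; split=> // j lj.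
  by rewrite -(sconsS d) e0.
by case: j lj => // j lj; rewrite sconsS e0.
Qed.

Lemma value_leading0 e : is_leading e 0 -> value e = e 0%N.
Proof. by case=> _ e0; rewrite (valueE e0) big_ord1 mulr1. Qed.

(** * Shortness *)

(** The bound excludes the two cases in which appending a digit changes the
    leading two: nothing to append to, and a single digit [1] or [-1] followed by
    its opposite. *)
Lemma is_short_scons d e : 2 <= value (scons d e) -> digit d ->
  is_short (scons d e) <-> is_short e.
Proof.
move=> ge2 dd; split=> -[l [lead short]].
  case: l lead short => [|l] lead short.
    (* a single digit does not reach 2 *)
    by move: ge2; rewrite value_leading0 // scons0; case: dd; lia.
  exists l; split; first exact/(is_leading_scons d).
  by case: l {lead} short => [|l]; rewrite /= ?sconsS => short []; auto.
exists l.+1; split; first exact/is_leading_scons.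
case: l lead short => [|l] lead short; rewrite /= !sconsS; last by case; auto.
(* appending the opposite of the single digit of e gives value 1 or -1 *)
move: ge2; rewrite value_scons (value_leading0 lead) scons0.
by move=> ge2 [_ []]; lia.
Qed.

(** By induction on the number of digits: two leading digits that are not
    opposite are worth at least [2 - 0] in absolute value, and appending a digit
    to a value [v] with [`|v| >= 2] gives at least [2 * 2 - 1]. *)
Lemma short_value_ge2 e l : (forall j, digit (e j)) -> is_leading e l.+1 ->
  ~ ((e l.+1 = 1 /\ e l = -1) \/ (e l.+1 = -1 /\ e l = 1)) ->
  2 <= `|value e|.
Proof.
elim: l e => [|l IH] e dig; rewrite -(scons_stail e) !sconsS ?scons0.
  move=> /is_leading_scons lead short; rewrite value_scons.
  have [nz _] := lead; rewrite (value_leading0 lead).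
  move: short nz; rewrite !stailE.
  by case: (dig 0%N) => ->; case: (dig 1%N) => ->; intuition lia.
move=> /is_leading_scons lead /(IH _ _ lead) ge2; rewrite value_scons.
have {}ge2 : 2 <= `|value (stail e)| by apply: ge2 => j; rewrite stailE.
by case: (dig 0%N) => ->; lia.
Qed.

Lemma short_small n e : `|n| <= 1 -> short_BSD n e ->
  is_leading e 0 /\ n = e 0%N.
Proof.
move=> n1 [[dig nE] [[|l] [lead short]]].
  by split=> //; rewrite -value_leading0.
have ge2 : 2 <= `|value e|.
  by apply: (short_value_ge2 dig lead) => op; apply: short.
by move: ge2; rewrite /value -nE; lia.
Qed.

Lemma short_BSD0 : short_BSD 0 = set0.
Proof.
by rewrite -subset0 => e /short_small[] // -[nz _] e0; apply: nz.
Qed.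

Lemma short_BSD1 : short_BSD 1 = [set scons 1 [fsfun]]%classic.
Proof.
apply/seteqP; split=> e /=.
  move=> /short_small[] // -[_ e0] e1.
  by apply/fsfunP => -[|j]; rewrite ?scons0 // sconsS fsfun0E e0.
have lead0 : is_leading (scons 1 [fsfun]) 0.
  by split=> [|[|j] //]; rewrite ?scons0 // sconsS fsfun0E.
move=> ->; split; last by exists 0%N; split=> // -[].
apply/is_BSD_scons; split; first by constructor 1.
  by move=> j; rewrite fsfun0E; constructor 2.
by rewrite /value finsupp0 big_seq_fset0.
Qed.

Lemma short_BSD_scons n d e m : 2 <= n -> digit d -> n = d + 2 * m ->
  short_BSD n (scons d e) <-> short_BSD m e.
Proof.
move=> n2 dd nE; split=> -[bsd short].
  have [_ de nE'] := (is_BSD_scons n d e).1 bsd.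
  have vE : value e = m by lia.
  split; first by split=> //; rewrite -vE.
  by apply: (is_short_scons _ dd).1 short; rewrite value_scons vE -nE.
have [de vE] := bsd; rewrite -/(value e) in vE; split.
  by apply/is_BSD_scons; split=> //; rewrite -vE.
by apply: (is_short_scons _ dd).2 short; rewrite value_scons -vE -nE.
Qed.

(** * The recurrence *)

Lemma short_BSD_double m : 1 <= m ->
  short_BSD (2 * m) = (scons 0 @` short_BSD m)%classic.
Proof.
move=> m1; have nE : 2 * m = 0 + 2 * m :> int by lia.
have cons0 e : short_BSD (2 * m) (scons 0 e) <-> short_BSD m e.
  by apply: short_BSD_scons nE; [lia | constructor 2].
apply/seteqP; split=> e /=; last by case=> f sf <-; apply/cons0.
rewrite -(scons_stail e) => sh.
have [/is_BSD_scons[d0 _ nE'] _] := sh.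
have e0 : e 0%N = 0 by case: d0; lia.
by rewrite e0 in sh *; exists (stail e) => //; apply/cons0.
Qed.

Lemma short_BSD_doubleS m : 1 <= m ->
  short_BSD (2 * m + 1) =
    (scons 1 @` short_BSD m `|` scons (-1) @` short_BSD (m + 1))%classic.
Proof.
move=> m1.
have cons1 e : short_BSD (2 * m + 1) (scons 1 e) <-> short_BSD m e.
  by apply: short_BSD_scons; [lia | constructor 1 | lia].
have consN1 e : short_BSD (2 * m + 1) (scons (-1) e) <-> short_BSD (m + 1) e.
  by apply: short_BSD_scons; [lia | constructor 3 | lia].
apply/seteqP; split=> e /=; last first.
  by case=> -[f sf <-]; [apply/cons1 | apply/consN1].
rewrite -(scons_stail e) => sh.
have [/is_BSD_scons[d0 _ nE'] _] := sh.
have [e0|e0] : e 0%N = 1 \/ e 0%N = -1 by case: d0; [auto | lia | auto].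
  by rewrite e0 in sh *; left; exists (stail e) => //; apply/cons1.
by rewrite e0 in sh *; right; exists (stail e) => //; apply/consN1.
Qed.

Lemma image_scons_fset d (A : {fset digit_seq}) :
  (scons d @` [set` A] = [set` [fset scons d e | e in A]%fset])%classic.
Proof.
apply/seteqP; split=> e /=; first by case=> f fA <-; apply/imfsetP; exists f.
by case/imfsetP => f /= fA ->; exists f.
Qed.

Lemma card_scons_fset d (A : {fset digit_seq}) :
  #|` [fset scons d e | e in A]%fset| = #|` A|.
Proof. by apply: card_imfset; apply: scons_inj. Qed.

(** An explicit finite set gives finiteness and the cardinality in the same
    induction. *)
Lemma short_BSD_fset (n : nat) : exists A : {fset digit_seq},
  short_BSD n%:Z = [set` A]%classic /\ #|` A| = stern n.
Proof.
elim/ltn_ind: n => n IH.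
have [n2|] := leqP 2 n; last first.
  case: n IH => [|[|//]] _ _.
    by exists fset0; rewrite short_BSD0 set_fset0 cardfs0.
  by exists [fset scons 1 [fsfun]]%fset; rewrite short_BSD1 set_fset1 cardfs1.
have [m m1 [nE|nE]] : exists2 m : nat,
  (1 <= m)%N & n = (2 * m)%N \/ n = (2 * m + 1)%N.
  by exists n./2; lia.
- have [|A [sA cA]] := IH m; first by lia.
  exists [fset scons 0 e | e in A]%fset.
  rewrite card_scons_fset -image_scons_fset -sA nE stern_double // PoszM.
  by rewrite short_BSD_double //; lia.
have [|A [sA cA]] := IH m; first by lia.
have [|B [sB cB]] := IH (m + 1)%N; first by lia.
exists ([fset scons 1 e | e in A] `|`
        [fset scons (-1)%R e | e in B])%fset; split.
  rewrite set_fsetU -!image_scons_fset -sA -sB nE.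
  by rewrite (PoszD m 1) PoszD PoszM short_BSD_doubleS //; lia.
have disj : [disjoint [fset scons 1 e | e in A]
                    & [fset scons (-1)%R e | e in B]]%fset.
  (* the last digits differ *)
  apply/fdisjointP => _ /imfsetP[e _ ->]; apply/imfsetP => -[f _].
  by move=> /(congr1 (fun g : digit_seq => g 0%N)); rewrite !scons0.
rewrite cardfsU (eqP disj) cardfs0 subn0 !card_scons_fset cA cB nE.
by rewrite stern_doubleS // addnC.
Qed.

End ShortRepresentations.

Theorem theorem1p1 : forall n : nat,
  finite_set (short_BSD n%:Z%R) /\ fbarBSD n%:Z%R = stern n.
Proof.
move=> n; have [A [sA cA]] := short_BSD_fset n.
by rewrite /fbarBSD sA set_fsetK; split=> //; apply: finite_fset.
Qed.
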